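(* Let $k\ge1$, $n\ge0$, $j\ge1$ be integers and let $p\in S_j$. For $i\ge0$ let $A_i$ be the number of permutations in $S_i$ that avoid $p$ (so $A_0=1$). Then the number of elements of $C_k\wr S_n$ that bi-avoid the pattern $(p,\,0^j)$ (where $0^j$ is the word of $j$ zeros) equals $$\sum_{\substack{i_1+\cdots+i_k=n\\ i_1,\ldots,i_k\ge 0}}A_{i_1}A_{i_2}\cdots A_{i_k}\binom{n}{i_1,\ldots,i_k}^2 .$$
   Context: For integers $k\ge1$, $n\ge0$, $C_k\wr S_n$ denotes the set of pairs $(\sigma,w)$ where $\sigma=\sigma_1\cdots\sigma_n$ is a permutation of $\{1,\dots,n\}$ in one-line notation and $w=w_1\cdots w_n\in\{0,1,\dots,k-1\}^n$. For a sequence of distinct integers, $\mathrm{red}$ replaces the $i$-th smallest entry by $i$; for a word over nonnegative integers, $\mathrm{red}$ replaces every occurrence of the $i$-th smallest distinct letter by $i-1$. A permutation $\sigma\in S_n$ avoids $p\in S_j$ if there are no indices $i_1<\cdots<i_j$ with $\mathrm{red}(\sigma_{i_1}\cdots\sigma_{i_j})=p$. A pattern $(\tau,u)$ (with $\tau\in S_j$, $u$ a word of length $j$ with $\mathrm{red}(u)=u$) bi-occurs in $(\sigma,w)$ if there are $1\le i_1<\cdots<i_j\le n$ (not necessarily adjacent) with $\mathrm{red}(\sigma_{i_1}\cdots\sigma_{i_j})=\tau$ and $\mathrm{red}(w_{i_1}\cdots w_{i_j})=u$; $(\sigma,w)$ bi-avoids $(\tau,u)$ if there is no bi-occurrence.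 In particular $(\sigma,w)$ bi-avoids $(p,0^j)$ iff there is no occurrence of $p$ in $\sigma$ at positions all having the same color. *)

(* Defs.v *)
From mathcomp Require Import all_boot all_fingroup.

Set Implicit Arguments.
Unset Strict Implicit.
Unset Printing Implicit Defensive.

(* [sort leq s] lists the entries in increasing order, so the i-th smallest
   entry (i = 1, 2, ...) sits at index i - 1 in it. *)
Definition red_perm (s : seq nat) : seq nat :=
  [seq (index x (sort leq s)).+1 | x <- s].

Definition red_word (s : seq nat) : seq nat :=
  [seq index x (sort leq (undup s)) | x <- s].

(* 'S_n permutes {0, ..., n-1}; the shift gives the usual one-line notation on
   {1, ..., n}, restricted here to a list of positions. *)
Definition entries n (s : 'S_n) (t : seq 'I_n) : seq nat :=
  [seq (s i).+1 | i <- t].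

Definition one_line n (s : 'S_n) : seq nat := entries s (enum 'I_n).

Definition increasing n (t : seq 'I_n) : bool := sorted ltn (map val t).

Definition occurs n j (p : 'S_j) (s : 'S_n) : bool :=
  [exists t : j.-tuple 'I_n,
    increasing t && (red_perm (entries s t) == one_line p)].

Definition avoids n j (p : 'S_j) (s : 'S_n) : bool := ~~ occurs p s.

Definition num_avoiding j (p : 'S_j) (i : nat) : nat :=
  #|[set s : 'S_i | avoids p s]|.

(* The underlying set of C_k wr S_n; color words are tuples over {0, ..., k-1}. *)
Definition wreath (k n : nat) : finType := ('S_n * n.-tuple 'I_k)%type.

Definition colors k n (w : n.-tuple 'I_k) (t : seq 'I_n) : seq nat :=
  [seq val (tnth w i) | i <- t].

(* A pattern (tau, u) is meant to satisfy [red_word u = u]. *)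
Definition bi_occurs k n j (pat : 'S_j * j.-tuple nat) (x : wreath k n) : bool :=
  [exists t : j.-tuple 'I_n,
    [&& increasing t,
        red_perm (entries x.1 t) == one_line pat.1 &
        red_word (colors x.2 t) == pat.2]].

Definition bi_avoids k n j (pat : 'S_j * j.-tuple nat) (x : wreath k n) : bool :=
  ~~ bi_occurs pat x.

Definition zero_word (j : nat) : j.-tuple nat := [tuple of nseq j 0].

Lemma red_zero_word j : red_word (zero_word j) = zero_word j.
Proof.
have undup0 m : undup (nseq m.+1 0) = [:: 0].
  by elim: m => //= m IHm; rewrite -[in RHS]IHm.
case: j => [|j] //; rewrite /red_word /zero_word [tval _]/=.
by rewrite -[_ :: _]/(nseq j.+1 0) undup0 map_nseq.
Qed.

(* The division is exact whenever the entries of [i] sum to [n]. *)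
Definition multinomial (n k : nat) (i : 'I_k -> nat) : nat :=
  n`! %/ \prod_(l < k) (i l)`!.

(* Main.v *)
Require Import Defs.
From mathcomp Require Import all_boot all_fingroup.

(* The color classes of [w] cut the positions, and those of [v := w o s^-1] cut
   the values, into blocks of equal sizes, and a permutation [s] with
   [v o s = w] is the same as a family of permutations of the blocks, one for
   each color.  A monochromatic occurrence of [p] lives in a single block, so
   for fixed [w] and [v] there are [\prod_c A_(m c)] permutations, where [m] is
   the common content of [w] and [v]; hence the square of the multinomial
   coefficient.  The multinomial coefficient itself comes from the same count,
   applied to a pattern too long to occur. *)

Set Implicit Arguments.
Unset Strict Implicit.
Unset Printing Implicit Defensive.

(** * Reductions, and increasing maps between ordinals *)

Lemma red_perm_map (T : eqType) (f g : T -> nat) (s : seq T) :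
    injective f -> injective g ->
    (forall x y, (f x <= f y) = (g x <= g y)) ->
  red_perm (map f s) = red_perm (map g s).
Proof.
move=> f_inj g_inj fg.
have sort_fg : sort (relpre f leq) s = sort (relpre g leq) s.
  have fg_rel : relpre g leq =2 relpre f leq by move=> x y /=; rewrite fg.
  (* Injectivity of [f] makes the pulled-back order antisymmetric, so the sorted rearrangement of
     [s] is unique. *)
  apply: (@sorted_eq _ (relpre f leq)).
  - by move=> y x z /=; apply: leq_trans.
  - by move=> x y /anti_leq/f_inj.
  - by apply: sort_sorted => x y; apply: leq_total.
  - by rewrite -(eq_sorted fg_rel); apply: sort_sorted => x y; apply: leq_total.
  - by rewrite perm_sort perm_sym perm_sort.
rewrite /red_perm -!map_comp; apply: eq_map => x /=.
by rewrite !sort_map !index_map // sort_fg.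
Qed.

Lemma red_word_constant (s : seq nat) :
  (red_word s == nseq (size s) 0) = constant s.
Proof.
apply/eqP/idP => [red0|/(constantP 0)[c ->]]; last first.
  have undup1 m : undup (nseq m.+1 c) = [:: c].
    by elim: m => //= m IHm; rewrite inE eqxx.
  rewrite /red_word size_nseq; case: (size s) => // m.
  by rewrite undup1 map_nseq /= eqxx.
(* Every letter has index 0 among the sorted letters, hence equals the smallest one. *)
apply/(constantP 0); exists (nth 0 (sort leq (undup s)) 0).
apply/all_pred1P/allP => x sx /=.
have: index x (sort leq (undup s)) \in red_word s by apply: map_f.
rewrite red0 => /nseqP[/esym idx0 _].
by rewrite {2}idx0 nth_index // mem_sort mem_undup.
Qed.

Section OrdinalEmbedding.
Variables (m n : nat) (e : 'I_m -> 'I_n).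
Hypothesis e_homo : forall a b : 'I_m, a < b -> e a < e b.

Lemma ord_homo_mono (a b : 'I_m) : (e a <= e b) = (a <= b).
Proof.
case: (ltngtP a b) => [/e_homo/ltnW->|/e_homo ba|/val_inj->]; rewrite ?leqnn //.
by apply/negbTE; rewrite -ltnNge.
Qed.

Lemma ord_homo_mono_lt (a b : 'I_m) : (e a < e b) = (a < b).
Proof. by rewrite !ltnNge ord_homo_mono. Qed.

Lemma ord_homo_inj : injective e.
Proof.
by move=> a b eab; apply/val_inj/eqP; rewrite eqn_leq -!ord_homo_mono eab leqnn.
Qed.

Lemma increasing_map (t : seq 'I_m) : increasing (map e t) = increasing t.
Proof.
rewrite /increasing !sorted_map; apply: eq_sorted => a b /=.
by rewrite ord_homo_mono_lt.
Qed.

End OrdinalEmbedding.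

(** The size of [P] is a separate variable [m], so that color classes of two words with equal
    contents can be enumerated from one and the same ordinal type. *)
Lemma ord_homo_exists n m (P : {set 'I_n}) : #|P| = m ->
  exists e : 'I_m -> 'I_n,
    [/\ forall a b : 'I_m, a < b -> e a < e b,
        forall a, e a \in P & forall i, i \in P -> exists a, e a = i].
Proof.
move=> <-; exists enum_val; split=> [a b ab|a|i Pi].
- have srt: sorted (relpre val ltn) (enum P).
    rewrite /(enum _) -enumT; apply: sorted_filter.
      by move=> ? ? ?; apply: ltn_trans.
    by rewrite -sorted_map val_enum_ord iota_ltn_sorted.
  have x0 := enum_val a; rewrite (enum_val_nth x0 a) (enum_val_nth x0 b).
  have tr: transitive (relpre (val : 'I_n -> nat) ltn).
    by move=> ? ? ?; apply: ltn_trans.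
  by apply: (sorted_ltn_nth tr _ srt) => //; rewrite inE -cardE.
- exact: enum_valP.
- by exists (enum_rank_in Pi i); apply: enum_rankK_in.
Qed.

Lemma increasing_size n (t : seq 'I_n) : increasing t -> size t <= n.
Proof.
move=> inc_t; have /card_uniqP <- : uniq t.
  rewrite -(map_inj_uniq val_inj).
  by apply: (sorted_uniq ltn_trans ltnn).
by rewrite -[n in _ <= n]card_ord max_card.
Qed.

(** * Patterns too long to occur *)

Lemma avoids_long n j (p : 'S_j) (s : 'S_n) : n < j -> avoids p s.
Proof.
move=> nj; apply/negP => /existsP[t /andP[/increasing_size]].
by rewrite size_tuple leqNgt nj.
Qed.

Lemma num_avoiding_long j (p : 'S_j) n : n < j -> num_avoiding p n = n`!.
Proof.
move=> nj; rewrite -card_Sn; apply: eq_card => s.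
by rewrite inE avoids_long.
Qed.

Lemma bi_avoids_long k n j (p : 'S_j) u (x : wreath k n) :
  n < j -> bi_avoids (p, u) x.
Proof.
move=> nj; apply/negP => /existsP[t /andP[/increasing_size]].
by rewrite size_tuple leqNgt nj.
Qed.

(** * Gluing permutations of the color blocks *)

Section Blocks.

Variables (k n : nat) (m : 'I_k -> nat).
Variables (w v : n.-tuple 'I_k) (e e' : forall c, 'I_(m c) -> 'I_n).
Hypothesis e_homo : forall c (a b : 'I_(m c)), a < b -> e a < e b.
Hypothesis e'_homo : forall c (a b : 'I_(m c)), a < b -> e' a < e' b.
Hypothesis e_color : forall c (a : 'I_(m c)), tnth w (e a) = c.
Hypothesis e'_color : forall c (a : 'I_(m c)), tnth v (e' a) = c.
Hypothesis e_surj : forall i, exists a : 'I_(m (tnth w i)), e a = i.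
Hypothesis e'_surj : forall i, exists a : 'I_(m (tnth v i)), e' a = i.

(* [e c] and [e' c] enumerate increasingly the positions, resp. values, of color
   [c]: the permutation [s] acts on the blocks through the family [f]. *)
Definition glues (f : forall c, 'S_(m c)) (s : 'S_n) :=
  forall c a, s (e a) = e' (f c a).

Lemma glues_color f s i : glues f s -> tnth v (s i) = tnth w i.
Proof. by move=> fs; have [a <-] := e_surj i; rewrite fs e'_color e_color. Qed.

Lemma glue_exists f : exists s, glues f s.
Proof.
have [r rP] := fin_all_exists e_surj.
pose g i := e' (f (tnth w i) (r i)).
have gE c a : g (e a) = e' (f c a).
  (* The type of [r (e a)] depends on the color of [e a], so it is generalized before that color
     becomes [c]; injectivity of [e] then identifies it with [a]. *)
  rewrite /g; move: (r _) (rP (e a)); rewrite e_color => b.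
  by move=> /(ord_homo_inj (@e_homo c)) ->.
have g_inj : injective g.
  move=> i i'; have [a <-] := e_surj i; have [a' <-] := e_surj i'.
  move: (tnth w i) (tnth w i') a a' => c c' a a'; rewrite !gE => gaa'.
  have cc' : c = c' by rewrite -(e'_color (f c a)) gaa' e'_color.
  case: c' / cc' a' gaa' => a' /(ord_homo_inj (@e'_homo c)).
  by move=> /perm_inj ->.
by exists (perm g_inj) => c a; rewrite permE gE.
Qed.

Lemma glue_restrict (s : 'S_n) :
  (forall i, tnth v (s i) = tnth w i) -> exists f, glues f s.
Proof.
move=> sP; apply: (@fin_all_exists _ _
  (fun c (g : 'S_(m c)) => forall a, s (e a) = e' (g a))) => c.
have: forall a : 'I_(m c), exists b : 'I_(m c), e' b = s (e a) :> 'I_n.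
  move=> a; have := e'_surj (s (e a)); rewrite sP e_color => -[b <-].
  by exists b.
case/fin_all_exists => g gE.
have g_inj : injective g.
  move=> a b ab; apply/(ord_homo_inj (@e_homo c))/(@perm_inj _ s).
  by rewrite -!gE ab.
by exists (perm g_inj) => a; rewrite permE gE.
Qed.

Lemma glues_fun f s s' : glues f s -> glues f s' -> s = s'.
Proof.
by move=> fs fs'; apply/permP => i; have [a <-] := e_surj i; rewrite fs fs'.
Qed.

Lemma glues_inj f f' s : glues f s -> glues f' s -> forall c, f c = f' c.
Proof.
move=> fs f's c; apply/permP => a; apply: (ord_homo_inj (@e'_homo c)).
by rewrite -fs f's.
Qed.

Lemma red_perm_block f s c (t : seq 'I_(m c)) : glues f s ->
  red_perm (entries s (map (@e c) t)) = red_perm (entries (f c) t).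
Proof.
move=> fs; rewrite /entries -map_comp.
apply: red_perm_map => [a b|a b|a b] /=.
- by case=> /val_inj/perm_inj/(ord_homo_inj (@e_homo c)).
- by case=> /val_inj/perm_inj.
- by rewrite !ltnS !fs (ord_homo_mono (@e'_homo c)).
Qed.

(** Positions of one color all lie in the image of a single [e c], and since [e c] and [e' c] are
    increasing, [s] has there the same reductions as [f c]. *)
Lemma bi_avoids_glues j (p : 'S_j) f s : 0 < j -> glues f s ->
  bi_avoids (p, zero_word j) (s, w) = [forall c, avoids p (f c)].
Proof.
move=> j_gt0 fs; rewrite -[RHS]negbK negb_forall; congr (~~ _).
apply/existsP/existsP => [[t /and3P[inc_t red_p red_0]]|[c]].
  (* As [j] is positive, the occurrence has a first position, whose color selects the block. *)
  pose i0 := tnth t (Ordinal j_gt0); pose c := tnth w i0; exists c.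
  have t_color l : tnth w (tnth t l) = c.
    have : constant (colors w t).
      by rewrite -red_word_constant size_map size_tuple.
    case/(constantP 0) => d Ed.
    have col i : i \in val t -> val (tnth w i) = d.
      move=> ti; have := map_f (fun i => val (tnth w i)) ti.
      by rewrite -/(colors w t) Ed => /nseqP[].
    by apply: val_inj; rewrite !col ?mem_tnth.
  have: forall l, exists a : 'I_(m c), e a = tnth t l.
    by move=> l; have [] := e_surj (tnth t l); rewrite t_color => a; exists a.
  case/fin_all_exists => a aE; rewrite negbK.
  have Et : val t = map (@e c) (mktuple a).
    rewrite -[RHS]/(val (map_tuple (@e c) (mktuple a))); congr val.
    by apply: eq_from_tnth => l; rewrite tnth_map tnth_mktuple aE.
  apply/existsP; exists (mktuple a).
  move: inc_t red_p; rewrite Et (increasing_map (@e_homo c)).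
  by rewrite (red_perm_block _ fs) => -> ->.
rewrite negbK => /existsP[t /andP[inc_t red_p]]; exists (map_tuple (@e c) t).
rewrite (increasing_map (@e_homo c)) inc_t (red_perm_block _ fs) red_p /=.
suff -> : colors w (map (@e c) t) = nseq (size t) (val c).
  have := constant_nseq (size t) (val c).
  by rewrite -red_word_constant size_nseq size_tuple.
by rewrite /colors; elim: (val t) => //= a r ->; rewrite e_color.
Qed.

(** Gluing is a bijection from the families of [p]-avoiding block permutations onto this set, and
    families are chosen independently for each color. *)
Lemma card_glued j (p : 'S_j) : 0 < j ->
  #|[set s : 'S_n | [forall i, tnth v (s i) == tnth w i]
                    & bi_avoids (p, zero_word j) (s, w)]|
  = \prod_c num_avoiding p (m c).
Proof.
move=> j_gt0.
have [g gP] :=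
  fin_all_exists (fun f : {dffun forall c, 'S_(m c)} => glue_exists f).
transitivity #|[set g f | f in family (fun c (s : 'S_(m c)) => avoids p s)]|.
  apply: eq_card => s; rewrite inE.
  apply/andP/imsetP => [[sP av]|[f /familyP fF ->]].
    have [f fs] : exists f, glues f s.
      by apply: glue_restrict => i; apply/eqP/(forallP sP).
    (* The family is turned into a finite function, the type on which [g] is defined and families
       are counted. *)
    have fs' : glues (finfun f : {dffun _}) s by move=> c a; rewrite ffunE.
    exists (finfun f); last exact: glues_fun (gP _).
    by apply/familyP; apply/forallP; rewrite -(bi_avoids_glues p j_gt0 fs').
  split; last by rewrite (bi_avoids_glues _ _ (gP f)) //; apply/forallP.
  by apply/forallP => i; rewrite (glues_color _ (gP f)).
rewrite card_imset => [|f f' ff']; last first.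
  by apply/ffunP; apply: (glues_inj (gP f)); rewrite ff'.
rewrite card_family foldrE big_map big_enum /=; apply: eq_bigr => c _.
by apply: eq_card => s; rewrite inE.
Qed.

End Blocks.

(** * Contents of color words *)

Definition content k n (w : n.-tuple 'I_k) : {ffun 'I_k -> 'I_n.+1} :=
  [ffun c => inord #|[set i | tnth w i == c]|].

(** A color class has at most [n] positions, so [inord] never truncates; the bounded type makes
    contents range over the summation index of the theorem. *)
Lemma contentE k n (w : n.-tuple 'I_k) c :
  content w c = #|[set i | tnth w i == c]| :> nat.
Proof. by rewrite ffunE inordK // ltnS -[n in _ <= n]card_ord max_card. Qed.

Lemma sum_content k n (w : n.-tuple 'I_k) : \sum_c content w c = n.
Proof.
rewrite -[RHS]card_ord -sum1_card (partition_big (tnth w) predT) //=.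
apply: eq_bigr => c _; rewrite contentE -sum1_card.
by apply: eq_bigl => i; rewrite inE.
Qed.

(** The disjoint union of the ordinals ['I_(i c)] has [n] elements; numbering them by ['I_n] and
    coloring each by its tag gives the word. *)
Lemma content_onto k n (i : {ffun 'I_k -> 'I_n.+1}) :
  \sum_c i c = n -> exists w : n.-tuple 'I_k, content w = i.
Proof.
move=> sum_i; pose T := {c : 'I_k & 'I_(i c)}.
have cardT : #|{: T}| = n.
  rewrite card_tagged sumnE big_map big_enum /= -[RHS]sum_i.
  by apply: eq_bigr => c _; rewrite card_ord.
pose g (a : 'I_n) : T := enum_val (cast_ord (esym cardT) a).
have g_inj : injective g by move=> a b /enum_val_inj/cast_ord_inj.
exists (mktuple (fun a => tag (g a))); apply/ffunP => c; apply: val_inj.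
rewrite /= contentE -[RHS]card_ord -(card_imset _ g_inj).
pose tag_c (y : 'I_(i c)) : T := Tagged _ y.
have tag_c_inj : injective tag_c by move=> y z /eqP; rewrite eq_Tagged => /eqP.
rewrite -(card_imset 'I_(i c) tag_c_inj); apply: eq_card => u.
apply/imsetP/imsetP => [[a]|[y _ ->]].
  rewrite inE tnth_mktuple => /eqP + ->; case: (g a) => d y /= dc.
  by case: c / dc @tag_c tag_c_inj => tag_c _; exists y.
exists (cast_ord cardT (enum_rank (tag_c y))).
  by rewrite inE tnth_mktuple /g cast_ordK enum_rankK.
by rewrite /g cast_ordK enum_rankK.
Qed.

(** * Counting for given words, then summing *)

Lemma count_same_content k n (w v : n.-tuple 'I_k) j (p : 'S_j) :
    0 < j -> content v = content w ->
  #|[set s : 'S_n | [forall i, tnth v (s i) == tnth w i]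
                    & bi_avoids (p, zero_word j) (s, w)]|
  = \prod_c num_avoiding p (content w c).
Proof.
move=> j_gt0 vw.
(* Both words are enumerated over the content of [w], so that positions and values of color [c]
   share the index type on which the block permutation acts. *)
have emb (u : n.-tuple 'I_k) : content u = content w ->
  exists e : forall c, 'I_(content w c) -> 'I_n,
    forall c, [/\ forall a b : 'I_(content w c), a < b -> e c a < e c b,
        forall a, tnth u (e c a) = c &
        forall i, tnth u i = c -> exists a, e c a = i].
  move=> uw; apply: (@fin_all_exists _ (fun c => 'I_(content w c) -> 'I_n)
    (fun c e => [/\ forall a b : 'I_(content w c), a < b -> e a < e b,
        forall a, tnth u (e a) = c &
        forall i, tnth u i = c -> exists a, e a = i])) => c.
  have [|e [e_homo e_in e_surj]] :=
    @ord_homo_exists n (content w c) [set i | tnth u i == c].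
    by rewrite -contentE uw.
  exists e; split=> // [a|i ui]; first by have := e_in a; rewrite inE => /eqP.
  by apply: e_surj; rewrite inE ui.
have [e eP] := emb w erefl; have [e' e'P] := emb v vw.
apply: (@card_glued _ _ (fun c => content w c) w v e e') => //.
- by move=> c; case: (eP c).
- by move=> c; case: (e'P c).
- by move=> c; case: (eP c).
- by move=> c; case: (e'P c).
- by move=> i; case: (eP (tnth w i)) => _ _; apply.
- by move=> i; case: (e'P (tnth v i)) => _ _; apply.
Qed.

(** [s] carries the color classes of [w] bijectively onto those of [v]. *)
Lemma content_perm k n (w v : n.-tuple 'I_k) (s : 'S_n) :
  (forall i, tnth v (s i) = tnth w i) -> content v = content w.
Proof.
move=> sP; apply/ffunP => c; apply: val_inj; rewrite /= !contentE.
rewrite -(card_imset [set i | tnth w i == c] (@perm_inj _ s)).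
apply: eq_card => i; rewrite inE -(permKV s i) sP.
by rewrite mem_imset ?inE //; apply: perm_inj.
Qed.

Lemma count_word k n (w : n.-tuple 'I_k) j (p : 'S_j) : 0 < j ->
  #|[set s : 'S_n | bi_avoids (p, zero_word j) (s, w)]|
  = #|[set v : n.-tuple 'I_k | content v == content w]|
    * \prod_c num_avoiding p (content w c).
Proof.
move=> j_gt0; pose push (s : 'S_n) := mktuple (fun i => tnth w (s^-1%g i)).
have pushP s v : (push s == v) = [forall i, tnth v (s i) == tnth w i].
  apply/eqP/forallP => [<- i|sP]; first by rewrite tnth_mktuple permK.
  by apply: eq_from_tnth => i; rewrite tnth_mktuple -(eqP (sP _)) permKV.
(* Permutations are sorted by the word [v] they push [w] to; each [v] with the content of [w]
   contributes the same product. *)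
rewrite -sum1_card (partition_big push (fun v => content v == content w)) /=.
  rewrite -sum_nat_const; under [RHS]eq_bigl do rewrite inE.
  apply: eq_bigr => v /eqP vw; rewrite -(count_same_content p j_gt0 vw).
  rewrite -sum1_card; apply: eq_bigl => s.
  by rewrite !inE pushP andbC.
move=> s _; apply/eqP; apply: (content_perm (s := s)) => i.
by rewrite tnth_mktuple permK.
Qed.

(** For a pattern of length [n.+1] every permutation avoids it, so [count_word] reads n! = N *
    (product of the factorials of the contents), with N the number of words sought. *)
Lemma card_content k n (i : {ffun 'I_k -> 'I_n.+1}) : \sum_c i c = n ->
  #|[set w | content w == i]| = multinomial n (fun c => i c).
Proof.
move=> /content_onto[w <-].
have := count_word w (1%g : 'S_n.+1) (ltn0Sn n).
rewrite (eq_bigr (fun c => (content w c)`!)) => [|c _]; last first.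
  by rewrite num_avoiding_long.
have -> : [set s : 'S_n | bi_avoids (1%g : 'S_n.+1, zero_word n.+1) (s, w)]
          = setT.
  by apply/setP => s; rewrite !inE bi_avoids_long.
rewrite cardsT card_Sn /multinomial => ->; rewrite mulnK //.
by rewrite prodn_gt0 // => c; apply: fact_gt0.
Qed.

Theorem theorem2 (k n j : nat) (hk : 1 <= k) (hj : 1 <= j) (p : 'S_j) :
  #|[set x : wreath k n | bi_avoids (p, zero_word j) x]| =
  \sum_(i : {ffun 'I_k -> 'I_n.+1} | \sum_(l < k) i l == n)
     (\prod_(l < k) num_avoiding p (i l)) * multinomial n (fun l : 'I_k => i l) ^ 2.
Proof.
rewrite -sum1_card (partition_big (fun x => x.2) predT) //=.
rewrite (partition_big (@content k n) (fun i => \sum_c i c == n)) => [|w _].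
  apply: eq_bigr => i /eqP sum_i.
  (* Each word of content [i] contributes this amount, and the number of such words is the
     multinomial coefficient again, whence the square. *)
  rewrite (eq_bigr (fun=> multinomial n (fun l => i l)
                          * \prod_l num_avoiding p (i l))) => [|w /eqP wi].
    rewrite sum_nat_const (_ : #|_| = #|[set w | content w == i]|); last first.
      by apply: eq_card => w; rewrite !inE.
    by rewrite card_content // mulnA mulnn mulnC.
  rewrite -card_content // -{1}wi -[in RHS]wi -count_word // -sum1_card.
  rewrite (reindex_onto (fun s => (s, w)) fst) => [|[s v] /= /andP[_ /eqP->]] //.
  by apply: eq_bigl => s; rewrite !inE !eqxx !andbT.
by rewrite sum_content.
Qed.
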